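(* Let $X$ be a real Banach space. For $f,g\in Lip_0^{ph}(X)$ define $f\odot g:X\to\mathbb{R}$ by $$(f\odot g)(x)=\begin{cases}\frac15\,\|x\|\,f\!\left(\frac{x}{\|x\|}\right)g\!\left(\frac{x}{\|x\|}\right), & x\neq 0,\\ 0,& x=0.\end{cases}$$ Then $f\odot g\in Lip_0^{ph}(X)$ and $Lip(f\odot g)\le Lip(f)\,Lip(g)$ for all $f,g\in Lip_0^{ph}(X)$, and $(Lip_0^{ph}(X),Lip(\cdot))$ equipped with the multiplication $\odot$ is a Banach algebra.
   Context: $Lip_0^{ph}(X)$ is the Banach space of all Lipschitz functions $f:X\to\mathbb{R}$ with $f(\alpha x)=\alpha f(x)$ for all $\alpha\ge0$, $x\in X$ (in particular $f(0)=0$), with norm $Lip(f)=\sup_{x\neq y}\frac{|f(x)-f(y)|}{\|x-y\|}$. A Banach algebra here is a Banach space with an associative bilinear multiplication whose norm is submultiplicative (with constant $1$); no unit of norm one is required. *)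

(* Defs.v *)
From HB Require Import structures.
From mathcomp Require Import all_boot all_order all_algebra.
From mathcomp Require Import all_classical all_reals all_analysis.

Set Implicit Arguments.
Unset Strict Implicit.
Unset Printing Implicit Defensive.

Import Order.TTheory GRing.Theory Num.Theory.
Import numFieldNormedType.Exports.

Local Open Scope classical_set_scope.
Local Open Scope ring_scope.

Section PositivelyHomogeneousLipschitz.
Context {R : realType} (X : normedModType R).
Implicit Types f g : X -> R.

Definition pos_homogeneous f :=
  forall (a : R) (x : X), 0 <= a -> f (a *: x) = a * f x.

Definition lip0ph : {pred X -> R} :=
  fun f => `[< lipschitz f /\ pos_homogeneous f >].

Definition lip_quotients f : set R :=
  [set `|f p.1 - f p.2| / `|p.1 - p.2| | p in [set p : X * X | p.1 != p.2]].

(* When X = {0} the set of quotients is empty and its sup is 0. *)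
Definition lip_norm f : R := sup (lip_quotients f).

Definition odot f g : X -> R := fun x =>
  if x == 0 then 0
  else 5^-1 * `|x| * f (`|x|^-1 *: x) * g (`|x|^-1 *: x).

Record lip0phType := Lip0ph {
  lip0ph_fun :> X -> R;
  lip0ph_funP : lip0ph_fun \in lip0ph }.

HB.instance Definition _ := [isSub for lip0ph_fun].
HB.instance Definition _ := [Choice of lip0phType by <:].

Lemma lip0phP f :
  reflect ((exists2 k : R, 0 <= k & forall x y, `|f x - f y| <= k * `|x - y|)
           /\ pos_homogeneous f) (f \in lip0ph).
Proof.
apply: (iffP (asboolP _)) => -[fl fh]; split=> //.
  have [k [kr kl]] := fl.
  exists (Num.max 0 (k + 1)); first by rewrite le_max lexx.
  move=> x y; apply: (kl (Num.max 0 (k + 1)) _ (x, y)) => //.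
  by rewrite lt_max ltrDl ltr01 orbT.
have [k k0 kl] := fl.
apply: (@klipschitzW _ _ _ k); first exact: (@globally_properfilter _ _ (0, 0)).
by move=> -[x y] _; exact: kl.
Qed.

Lemma lip0ph_submod_closed : submod_closed (lip0ph : {pred X -> R^o}).
Proof.
split=> [|a f g /lip0phP[[k k0 kf] fh] /lip0phP[[l l0 lg] gh]].
  apply/lip0phP; split=> [|a x _]; last by rewrite mulr0.
  by exists 0 => // x y; rewrite subrr normr0 mul0r.
apply/lip0phP; split; last first.
  move=> b x b0; rewrite !fctE fh// gh// mulrDr.
  by congr (_ + _); exact: mulrCA.
exists (`|a| * k + l) => [|x y]; first by rewrite addr_ge0// mulr_ge0.
rewrite !fctE opprD addrACA -scalerBr (le_trans (ler_normD _ _))//.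
by rewrite mulrDl lerD// normrZ -mulrA ler_wpM2l.
Qed.

HB.instance Definition _ :=
  GRing.isSubmodClosed.Build R (X -> R^o) lip0ph lip0ph_submod_closed.
HB.instance Definition _ :=
  [SubChoice_isSubLmodule of lip0phType by <:].

Lemma lip_quotients_ub f : f \in lip0ph -> has_ubound (lip_quotients f).
Proof.
move=> /lip0phP[[k k0 kf] _]; exists k => _ [[x y]/= xy <-].
by rewrite ler_pdivrMr ?normr_gt0 ?subr_eq0.
Qed.

Lemma lip_norm_ge0 f : 0 <= lip_norm f.
Proof.
have [[[_ [p pn _]] bq]|/sup_out s0] := pselect (has_sup (lip_quotients f)).
  apply: le_trans (ub_le_sup bq _); last by exists p.
  by rewrite divr_ge0.
by rewrite /lip_norm s0.
Qed.

Lemma lip_norm_lip f x y : f \in lip0ph ->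
  `|f x - f y| <= lip_norm f * `|x - y|.
Proof.
move=> fL; have [->|xy] := eqVneq x y; first by rewrite !subrr !normr0 mulr0.
rewrite -ler_pdivrMr ?normr_gt0 ?subr_eq0//.
by apply: ub_le_sup; [exact: lip_quotients_ub|exists (x, y)].
Qed.

Lemma lip_norm_le f (k : R) : 0 <= k ->
  (forall x y, `|f x - f y| <= k * `|x - y|) -> lip_norm f <= k.
Proof.
move=> k0 kf; have [q0|/set0P qN0] := eqVneq (lip_quotients f) set0.
  by rewrite /lip_norm q0 sup0.
apply: ge_sup => // _ [[x y]/= xy <-].
by rewrite ler_pdivrMr ?normr_gt0 ?subr_eq0.
Qed.

Implicit Types u v : lip0phType.

Let ler_lip_normD u v : lip_norm (u + v) <= lip_norm u + lip_norm v.
Proof.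
apply: lip_norm_le => [|x y]; first by rewrite addr_ge0 ?lip_norm_ge0.
rewrite GRing.valD/= !fctE opprD addrACA (le_trans (ler_normD _ _))//.
by rewrite mulrDl lerD// lip_norm_lip// lip0ph_funP.
Qed.

Let lip_normZ_le (a : R) u : lip_norm (a *: u) <= `|a| * lip_norm u.
Proof.
apply: lip_norm_le => [|x y]; first by rewrite mulr_ge0 ?lip_norm_ge0.
rewrite GRing.valZ/= !fctE -scalerBr normrZ -mulrA ler_wpM2l//.
by rewrite lip_norm_lip// lip0ph_funP.
Qed.

Let lip_normZ (a : R) u : lip_norm (a *: u) = `|a| * lip_norm u.
Proof.
apply/eqP; rewrite eq_le lip_normZ_le/=.
have [->|a0] := eqVneq a 0; first by rewrite normr0 mul0r lip_norm_ge0.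
rewrite -ler_pdivlMl ?normr_gt0// -normfV.
by rewrite -[in leLHS](scalerK a0 u) lip_normZ_le.
Qed.

Let lip_norm_eq0 u : lip_norm u = 0 -> u = 0.
Proof.
move=> u0; apply/val_inj/funext => x /=.
have /lip0phP[_ uh] := lip0ph_funP u.
have ux0 : u 0 = 0 by rewrite -[X in u X](scale0r 0) uh// mul0r.
have := lip_norm_lip x 0 (lip0ph_funP u).
by rewrite u0 mul0r ux0 subr0 normr_le0 => /eqP.
Qed.

HB.instance Definition _ := Lmodule_isNormed.Build R lip0phType
  ler_lip_normD lip_normZ lip_norm_eq0.

Lemma lip0ph_normE u : `|u| = lip_norm u.
Proof. by []. Qed.

End PositivelyHomogeneousLipschitz.

Arguments lip0ph {R} X _.

(* The first clause is the axiom of completeType; no unit is required. *)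
Definition is_banach_algebra (R : realType) (A : normedModType R)
    (mul : A -> A -> A) : Prop :=
  [/\ forall F : set_system A, ProperFilter F -> cauchy F -> cvg F,
      bilinear_for *:%R *:%R mul,
      associative mul
    & forall a b : A, `|mul a b| <= `|a| * `|b| ].

(* Main.v *)
Require Import Defs.
From mathcomp Require Import all_boot all_order all_algebra.
From mathcomp Require Import ring lra.
From mathcomp Require Import all_classical all_reals all_analysis.

Set Implicit Arguments.
Unset Strict Implicit.
Unset Printing Implicit Defensive.

Import Order.TTheory GRing.Theory Num.Theory.
Import numFieldNormedType.Exports.

Local Open Scope classical_set_scope.
Local Open Scope ring_scope.

(** By homogeneity, [f ⊙ g] is [f * g] divided by [5 * norm]. For
[0 < q := |y| <= p := |x|], the difference [f x * g x / p - f y * g y / q]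
splits as
  [(f x - f y) * (g x / p) + (f y / p) * (g x - g y)
   + (f y / q) * (g y / q) * (q - p) * (q / p)],
and each of the three terms is at most [Lip f * Lip g * |x - y|], so the factor
[1/5] (indeed [1/3]) suffices. Completeness: a Cauchy filter converges
pointwise, and a Lipschitz bound that holds eventually passes to the
pointwise limit. *)

Lemma lip0ph_scale (R : realType) (X : normedModType R) (f : X -> R)
    (a : R) (x : X) : f \in lip0ph X -> 0 <= a -> f (a *: x) = a * f x.
Proof. by move=> /lip0phP[_ fh] a0; exact: fh. Qed.

Lemma lip0ph0 (R : realType) (X : normedModType R) (f : X -> R) :
  f \in lip0ph X -> f 0 = 0.
Proof.
by move=> fL; rewrite -[X in f X](scale0r (0 : X)) (lip0ph_scale _ fL)// mul0r.
Qed.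

Lemma lip0ph_norm_le (R : realType) (X : normedModType R) (f : X -> R) (x : X) :
  f \in lip0ph X -> `|f x| <= lip_norm f * `|x|.
Proof.
by move=> fL; have := lip_norm_lip x 0 fL; rewrite lip0ph0// !subr0.
Qed.

(* At [x = 0] both sides vanish, since [0^-1 = 0]. *)
Lemma odotE (R : realType) (X : normedModType R) (f g : X -> R) (x : X) :
  f \in lip0ph X -> g \in lip0ph X ->
  odot f g x = 5^-1 * `|x|^-1 * (f x * g x).
Proof.
move=> fL gL; rewrite /odot; have [->|x0] := eqVneq x 0.
  by rewrite normr0 invr0 mulr0 mul0r.
rewrite (lip0ph_scale _ fL) ?invr_ge0// (lip0ph_scale _ gL) ?invr_ge0//.
by field; rewrite normr_eq0.
Qed.

(** Scalar core of the product estimate: [p], [a], [b] stand for the norm, [f] and [g] at [x], the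
    letters [q], [a'], [b'] for the same at [y], and [d] for the distance from [x] to [y]. *)
Lemma ler_dist_divM (K : realFieldType) (F G d p q a a' b b' : K) :
  0 <= F -> 0 <= G -> 0 <= q <= p ->
  `|a'| <= F * q -> `|b| <= G * p -> `|b'| <= G * q ->
  `|a - a'| <= F * d -> `|b - b'| <= G * d -> `|q - p| <= d ->
  `|p^-1 * (a * b) - q^-1 * (a' * b')| <= 3 * (F * G * d).
Proof.
move=> F0 G0 /andP[q0 qp] a'q bp b'q aa' bb' pqd.
(* The case [r = 0] holds because [c / 0 = 0], so a vanishing norm needs no separate bound. *)
have ler_div (c C r : K) : 0 <= C -> 0 <= r -> `|c| <= C * r -> `|c / r| <= C.
  move=> C0; rewrite le_eqVlt => /predU1P[<- _|r0 cC].
    by rewrite invr0 mulr0 normr0.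
  by rewrite normrM normfV (gtr0_norm r0) ler_pdivrMr.
have d0 : 0 <= d := le_trans (normr_ge0 _) pqd.
have p0 := le_trans q0 qp.
have FGd : 0 <= F * G * d by rewrite !mulr_ge0.
have bp' : `|b / p| <= G by exact: ler_div.
have t1 : `|(a - a') * (b / p)| <= F * d * G by rewrite normrM ler_pM.
(* If [q = 0] then [a' = 0], and only the first term of the splitting survives; [p] may vanish here
   too. *)
have [q_eq0|qN0] := eqVneq q 0.
  move: a'q; rewrite q_eq0 mulr0 normr_le0 => /eqP a'0.
  move: t1; rewrite a'0 subr0 invr0 mul0r subr0.
  have -> : a * (b / p) = p^-1 * (a * b) by ring.
  lra.
have q_gt0 : 0 < q by rewrite lt_neqAle eq_sym qN0.
have p_gt0 : 0 < p := lt_le_trans q_gt0 qp.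
have pN0 : p != 0 by rewrite gt_eqF.
have -> : p^-1 * (a * b) - q^-1 * (a' * b') =
    (a - a') * (b / p) + (a' / p) * (b - b')
    + (a' / q) * (b' / q) * ((q - p) * (q / p)).
  by field; rewrite pN0 qN0.
have a'p : `|a' / p| <= F.
  by apply: ler_div => //; apply: le_trans a'q _; rewrite ler_wpM2l.
have t2 : `|(a' / p) * (b - b')| <= F * (G * d) by rewrite normrM ler_pM.
have t3 : `|(a' / q) * (b' / q) * ((q - p) * (q / p))| <= F * G * (d * 1).
  rewrite normrM ler_pM//; rewrite normrM ler_pM ?ler_div//.
  by rewrite mul1r ger0_norm.
apply: le_trans (ler_normD _ _) _.
apply: le_trans (lerD (ler_normD _ _) (lexx _)) _.
lra.
Qed.

Lemma odot_dist_le (R : realType) (X : normedModType R) (f g : X -> R)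
    (x y : X) : f \in lip0ph X -> g \in lip0ph X ->
  `|odot f g x - odot f g y| <= lip_norm f * lip_norm g * `|x - y|.
Proof.
move=> fL gL; wlog yx : x y / `|y| <= `|x|.
  move=> H; have [|/ltW xy] := leP `|y| `|x|; first exact: H.
  by rewrite distrC [`|x - y|]distrC H.
rewrite !odotE// -!mulrA -mulrBr normrM ger0_norm ?invr_ge0//.
rewrite ler_pdivrMl// mulrA.
apply: le_trans (@ler_dist_divM _ (lip_norm f) (lip_norm g) `|x - y|
  _ _ _ _ _ _ _ _ _ _ _ _ _ _ _) _.
all: rewrite ?lip_norm_ge0 ?normr_ge0 ?lip0ph_norm_le ?lip_norm_lip//.
  by rewrite distrC ler_dist_dist.
(* The factor [5^-1] has become a 5 on the right, so what remains is [3 <= 5]. *)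
by rewrite -mulrA ler_wpM2r ?ler_nat// !mulr_ge0 ?lip_norm_ge0.
Qed.

Lemma odot_lip0ph (R : realType) (X : normedModType R) (f g : X -> R) :
  f \in lip0ph X -> g \in lip0ph X -> odot f g \in lip0ph X.
Proof.
move=> fL gL; apply/lip0phP; split=> [|a x a0].
  exists (lip_norm f * lip_norm g); first by rewrite mulr_ge0 ?lip_norm_ge0.
  by move=> x y; exact: odot_dist_le.
rewrite !odotE// (lip0ph_scale _ fL)// (lip0ph_scale _ gL)// normrZ ger0_norm//.
have [->|an0] := eqVneq a 0; first by rewrite !mul0r mulr0.
have [->|x0] := eqVneq x 0; first by rewrite normr0 mulr0 invr0 mulr0 !mul0r mulr0.
by field; rewrite normr_eq0 x0 an0.
Qed.

Lemma lip_norm_odot_le (R : realType) (X : normedModType R) (f g : X -> R) :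
  f \in lip0ph X -> g \in lip0ph X ->
  lip_norm (odot f g) <= lip_norm f * lip_norm g.
Proof.
move=> fL gL; apply: lip_norm_le => [|x y]; last exact: odot_dist_le.
by rewrite mulr_ge0 ?lip_norm_ge0.
Qed.

Definition lip0ph_mul (R : realType) (X : normedModType R)
    (f g : lip0phType X) : lip0phType X :=
  Lip0ph (odot_lip0ph (lip0ph_funP f) (lip0ph_funP g)).

Lemma lip0ph_mulE (R : realType) (X : normedModType R) (f g : lip0phType X)
    (x : X) : lip0ph_mul f g x = 5^-1 * `|x|^-1 * (f x * g x).
Proof. by rewrite /= odotE ?lip0ph_funP. Qed.

Lemma lip0ph_linE (R : realType) (X : normedModType R) (a : R)
  (f g : lip0phType X) (x : X) : (a *: f + g) x = a * f x + g x.
Proof. by []. Qed.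

Lemma lip0ph_mul_bilinear (R : realType) (X : normedModType R) :
  bilinear_for *:%R *:%R (@lip0ph_mul R X).
Proof.
split=> [h|h] a f g; apply/val_inj/funext => x.
  change (lip0ph_mul (a *: f + g) h x =
    a * lip0ph_mul f h x + lip0ph_mul g h x).
  by rewrite !lip0ph_mulE lip0ph_linE; ring.
change (lip0ph_mul h (a *: f + g) x =
  a * lip0ph_mul h f x + lip0ph_mul h g x).
by rewrite !lip0ph_mulE lip0ph_linE; ring.
Qed.

(** By [lip0ph_mulE], both sides at [x] are [f x * g x * h x] times the square of [5^-1 * |x|^-1];
    this is a ring identity in [|x|^-1], valid also at [x = 0]. *)
Lemma lip0ph_mulA (R : realType) (X : normedModType R) :
  associative (@lip0ph_mul R X).
Proof.
move=> f g h; apply/val_inj/funext => x.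
change (lip0ph_mul f (lip0ph_mul g h) x = lip0ph_mul (lip0ph_mul f g) h x).
by rewrite !lip0ph_mulE; ring.
Qed.

Lemma lip0ph_dist_le (R : realType) (X : normedModType R) (f : lip0phType X)
    (x y : X) : `|f x - f y| <= `|f| * `|x - y|.
Proof. exact/lip_norm_lip/lip0ph_funP. Qed.

Lemma lip0ph_eval_le (R : realType) (X : normedModType R) (f g : lip0phType X)
    (x : X) : `|f x - g x| <= `|f - g| * `|x|.
Proof. exact: (lip0ph_norm_le x (lip0ph_funP (f - g))). Qed.

Lemma pointwise_lim_dist_le (R : realType) (X : normedModType R) {T : Type}
    {F : set_system T} {FF : ProperFilter F} (u : T -> X -> R) (l : X -> R)
    (k : R) :
  (forall x, u t x @[t --> F] --> l x) ->
  (\forall t \near F, forall x y, `|u t x - u t y| <= k * `|x - y|) ->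
  forall x y, `|l x - l y| <= k * `|x - y|.
Proof.
move=> ul uk x y.
have cv : `|u t x - u t y| @[t --> F] --> `|l x - l y|.
  by apply: cvg_norm; apply: cvgB; exact: ul.
(* A closed half-line containing the values eventually also contains their limit. *)
apply: (closed_cvg (fun r : R => r <= k * `|x - y|) _ _ _ cv).
  exact: closed_le.
by apply: filterS uk => t; apply.
Qed.

Lemma lip0ph_complete (R : realType) (X : normedModType R)
    (F : set_system (lip0phType X)) : ProperFilter F -> cauchy F -> cvg F.
Proof.
move=> FF /cauchyP Fc.
have ball_lip (f0 f : lip0phType X) (e : R) : ball f0 e f -> `|f0 - f| <= e.
  by rewrite -ball_normE => /ltW.
have ev_cvg x : cvg ((f x : R) @[f --> F]).
  apply/cauchy_cvgP/cauchyP => e e0.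
  (* Evaluation at [x] multiplies distances by at most [|x|]; the added 1 avoids division by zero
     and makes the final bound strict. *)
  have d0 : 0 < e / (`|x| + 1) by rewrite divr_gt0// ltr_wpDl.
  have [f0 Ff0] := Fc _ d0; exists (f0 x).
  change (F [set f : lip0phType X | ball (f0 x) e (f x)]).
  apply: filterS Ff0 => f /ball_lip ff0.
  rewrite -ball_normE /=; apply: le_lt_trans (lip0ph_eval_le f0 f x) _.
  apply: le_lt_trans (ler_wpM2r (normr_ge0 x) ff0) _.
  by rewrite mulrAC ltr_pdivrMr ?ltr_wpDl// ltr_pM2l// ltrDl.
pose l x : R := lim ((f x : R) @[f --> F]).
have Fl x : (f x : R) @[f --> F] --> l x by exact: ev_cvg.
(* If [F] is eventually [e]-close to [f0], so is its pointwise limit [l] in the Lipschitz seminorm.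
   With [e = 1] this shows [l] Lipschitz; with half the tolerance it gives norm convergence. *)
have near_lip (f0 : lip0phType X) e : F (ball f0 e) ->
    forall x y, `|(l x - f0 x) - (l y - f0 y)| <= e * `|x - y|.
  move=> Ff0.
  apply: (@pointwise_lim_dist_le _ _ _ F _
    (fun (f : lip0phType X) x => f x - f0 x)) => [x|].
    by apply: cvgB; [exact: Fl|exact: cvg_cst].
  apply: filterS Ff0 => f /ball_lip; rewrite distrC => ff0 x y.
  apply: le_trans (lip0ph_dist_le (f - f0) x y) _.
  by rewrite ler_wpM2r.
have lL : l \in lip0ph X.
  apply/lip0phP; split.
    have [f0 Ff0] := Fc 1 ltr01.
    exists (1 + `|f0|) => [|x y]; first by rewrite addr_ge0.
    have -> : l x - l y = (l x - f0 x - (l y - f0 y)) + (f0 x - f0 y) by ring.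
    apply: le_trans (ler_normD _ _) _.
    by rewrite mulrDl lerD ?near_lip// lip0ph_dist_le.
  (* Homogeneity of [l]: the values [f (a *: x) = a * f x] tend to both [l (a *: x)] and [a * l x],
     and limits in [R] are unique. *)
  move=> a x a0.
  have afl : (fun f : lip0phType X => a * f x) @ F --> a * l x.
    by apply: cvgMl_tmp; exact: Fl.
  have hom : (fun f : lip0phType X => a * f x) = (fun f => f (a *: x)).
    by apply/funext => f; rewrite (lip0ph_scale _ (lip0ph_funP f)).
  by rewrite hom in afl; exact: (cvg_unique _ (Fl (a *: x)) afl).
apply/cvg_ex; exists (Lip0ph lL); apply/(@cvgrPdist_le _ _ _ _ _ id) => e e0.
have e20 : 0 < e / 2 by rewrite divr_gt0.
have [f0 Ff0] := Fc _ e20.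
(* Triangle inequality through the centre [f0]: both [l] and [f] lie within [e / 2] of it. *)
apply: filterS (Ff0) => f /ball_lip ff0.
rewrite -[leLHS](_ : `|(Lip0ph lL - f0) + (f0 - f)| = _); last first.
  by rewrite addrA subrK.
rewrite (splitr e); apply: le_trans (ler_normD _ _) _.
rewrite lerD// lip0ph_normE; apply: lip_norm_le; first exact: ltW.
exact: near_lip Ff0.
Qed.

Theorem mainTheorem7 (R : realType) (X : completeNormedModType R) :
  (forall f g : X -> R, f \in lip0ph X -> g \in lip0ph X ->
     odot f g \in lip0ph X /\
     lip_norm (odot f g) <= lip_norm f * lip_norm g) /\
  (exists mul : lip0phType X -> lip0phType X -> lip0phType X,
     (forall f g : lip0phType X, mul f g = odot f g :> (X -> R)) /\
     is_banach_algebra mul).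
Proof.
split=> [f g fL gL|].
  by split; [exact: odot_lip0ph|exact: lip_norm_odot_le].
exists (@lip0ph_mul R X); split=> //; split.
- exact: lip0ph_complete.
- exact: lip0ph_mul_bilinear.
- exact: lip0ph_mulA.
- by move=> f g; apply: lip_norm_odot_le; exact: lip0ph_funP.
Qed.
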